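(* Let $X=c_0$, let $e_n=(0,\dots,0,1,0,\dots)$ (the $n$th entry is $1$, the others $0$), and let $e:=(1,1,\dots,1,\dots)\in\ell^\infty=X^{**}$. Let $A:c_0\rightrightarrows\ell^1$ be defined by $$\operatorname{gra}A:=\Big\{\Big(\sum_n\big(-\sum_{i>n}\langle e_i,y^*\rangle+\sum_{i<n}\langle e_i,y^*\rangle\big)e_n,\ y^*\Big)\in c_0\times\ell^1\ \Big|\ y^*\in\{e\}_\bot\Big\}$$ (thus $A=T_e$, where $\operatorname{gra}T_e=\{(-G(x^* ),x^* )\mid x^*\in\ell^1,\langle x^*,e\rangle=0\}$ and $G:\ell^1\to\ell^\infty$ is Gossez's operator $(G(x^* ))_n=\sum_{i>n}x_i^*-\sum_{i<n}x_i^*$). Then $A$ is a maximally monotone and skew operator that is neither of type (BR) nor unique, and so $A$ is not of type (D). Hence, every Banach space that contains an isomorphic copy of $c_0$ is not of type (D).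
   Context: All Banach spaces are real; a Banach space $X$ is identified with its canonical image in $X^{**}$, and $\langle\cdot,\cdot\rangle$ denotes duality pairings (arguments in either order). $c_0$ carries the sup norm, with $c_0^*=\ell^1$ and $c_0^{**}=\ell^\infty$. $\{e\}_\bot=\{y^*\in\ell^1\mid\langle e,y^*\rangle=0\}$. A set-valued operator $B:X\rightrightarrows X^*$ has graph $\operatorname{gra}B=\{(x,x^* )\mid x^*\in Bx\}$. It is monotone if $\langle x-y,x^*-y^*\rangle\ge0$ for all $(x,x^* ),(y,y^* )\in\operatorname{gra}B$, maximally monotone if moreover it has no proper monotone extension (graph inclusion), and skew if $\langle x,x^*\rangle=0$ for all $(x,x^* )\in\operatorname{gra}B$. A maximally monotone $B:X\rightrightarrows X^*$ is: - of type (D) if for every $(x^{**},x^* )\in X^{**}\times X^*$ with $\inf_{(a,a^* )\in\operatorname{gra}B}\langle a-x^{**},a^*-x^*\rangle\ge0$ there is a bounded net in $\operatorname{gra}B$ converging weak$^*\times$strong to $(x^{**},x^* )$; - of type (BR) if whenever $(x,x^* )\in X\times X^*$, $\alpha,\beta>0$ and $\inf_{(a,a^* )\in\operatorname{gra}B}\langle x-a,x^*-a^*\rangle>-\alpha\beta$, there exists $(b,b^* )\in\operatorname{gra}B$ with $\|x-b\|<\alpha$ and $\|x^*-b^*\|<\beta$; - unique if all maximally monotone extensions of $B$ (graph inclusion) in $X^{**}\times X^*$ coincide. A Banach space is of type (D) if every maximally monotone operator on it is of type (D). *)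

(* Defs.v *)
From HB Require Import structures.
From mathcomp Require Import all_boot all_order all_algebra.
From mathcomp Require Import all_classical all_reals all_analysis.

Set Implicit Arguments.
Unset Strict Implicit.
Unset Printing Implicit Defensive.
Import Order.TTheory GRing.Theory Num.Theory.
Import numFieldNormedType.Exports.

Local Open Scope classical_set_scope.
Local Open Scope ring_scope.

Section Dual.
Context {R : realType} {X : normedModType R}.

Definition dual_pred : {pred X -> R^o} :=
  fun f => `[< linear f /\ continuous f >].

(* The topological dual, normed by the operator norm dual_norm below. *)
Record dual := Dual { dual_fun :> X -> R^o; _ : dual_fun \in dual_pred }.

HB.instance Definition _ := [isSub for dual_fun].
HB.instance Definition _ := [Choice of dual by <:].

Lemma dual_submod_closed : submod_closed dual_pred.
Proof.
split.
  apply/asboolP; split; last exact: cst_continuous.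
  by move=> a u v; rewrite scaler0 addr0.
move=> a f g /asboolP[lf cf] /asboolP[lg cg]; apply/asboolP; split.
  move=> b u v /=.
  rewrite !(fctE, GRing.scalerDr, lf, lg) /= !scalerA (mulrC a b).
  by rewrite addrACA.
by move=> x; apply: cvgD; [apply: cvgZl_tmp; exact: cf | exact: cg].
Qed.

HB.instance Definition _ :=
  GRing.isSubmodClosed.Build R (X -> R^o) dual_pred dual_submod_closed.
HB.instance Definition _ := [SubChoice_isSubLmodule of dual by <:].

Lemma dual_linear (f : dual) : linear f.
Proof. by case: f => f /= /asboolP[]. Qed.

HB.instance Definition _ (f : dual) :=
  GRing.isLinear.Build R X R^o _ f (dual_linear f).

Lemma dual_continuous (f : dual) : continuous f.
Proof. by case: f => f /= /asboolP[]. Qed.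

Definition dual_norm (f : dual) : R :=
  sup [set `|f x| | x in [set x : X | `|x| <= 1]].

Lemma dual_has_sup (f : dual) :
  has_sup [set `|f x| | x in [set x : X | `|x| <= 1]].
Proof.
split; first by exists `|f 0|; exists 0 => //=; rewrite normr0.
have /linear_bounded_continuous/linear_boundedP/pinfty_ex_gt0[M M0 fM] :=
  @dual_continuous f.
exists M => _ [x /= x1 <-]; apply: le_trans (fM x) _.
by rewrite ler_piMr// ltW.
Qed.

Lemma dual_norm_ge0 (f : dual) : 0 <= dual_norm f.
Proof.
apply: le_trans (normr_ge0 (f 0)) _; apply: ub_le_sup.
  exact: (dual_has_sup f).2.
by exists 0 => //=; rewrite normr0.
Qed.

Lemma dual_norm_bound (f : dual) (x : X) : `|f x| <= dual_norm f * `|x|.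
Proof.
have [->|x0] := eqVneq x 0; first by rewrite linear0 !normr0 mulr0.
rewrite -ler_pdivrMr ?normr_gt0//; apply: ub_le_sup.
  exact: (dual_has_sup f).2.
exists (`|x|^-1 *: x); first by rewrite /= normfZV.
by rewrite linearZ normrZ /= ger0_norm ?invr_ge0// mulrC.
Qed.

Lemma dual_norm_le (f : dual) (M : R) :
  (forall x : X, `|x| <= 1 -> `|f x| <= M) -> dual_norm f <= M.
Proof.
move=> fM; apply: ge_sup; first exact: (dual_has_sup f).1.
by move=> _ [x x1 <-]; exact: fM.
Qed.

Lemma dual_normD (f g : dual) : dual_norm (f + g) <= dual_norm f + dual_norm g.
Proof.
apply: dual_norm_le => x x1; apply: le_trans (ler_normD _ _) _.
by apply: lerD; apply: le_trans (dual_norm_bound _ _) _;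
  rewrite ler_piMr// dual_norm_ge0.
Qed.

Lemma dual_normZ_le (l : R) (f : dual) :
  dual_norm (l *: f) <= `|l| * dual_norm f.
Proof.
apply: dual_norm_le => x x1.
rewrite normrZ ler_wpM2l//; apply: le_trans (dual_norm_bound _ _) _.
by rewrite ler_piMr// dual_norm_ge0.
Qed.

Lemma dual_normZ (l : R) (f : dual) :
  dual_norm (l *: f) = `|l| * dual_norm f.
Proof.
apply/eqP; rewrite eq_le dual_normZ_le/=.
have [->|l0] := eqVneq l 0; first by rewrite normr0 mul0r dual_norm_ge0.
rewrite -ler_pdivlMl ?normr_gt0//.
rewrite -{1}[f]scale1r -(mulVf l0) -scalerA.
by apply: le_trans (dual_normZ_le _ _) _; rewrite normfV.
Qed.

Lemma dual_norm0_eq0 (f : dual) : dual_norm f = 0 -> f = 0.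
Proof.
move=> f0; apply/val_inj/funext => x /=; apply/normr0_eq0/eqP.
by rewrite eq_le normr_ge0 andbT -(mul0r `|x|) -f0 dual_norm_bound.
Qed.

HB.instance Definition _ :=
  Lmodule_isNormed.Build R dual dual_normD dual_normZ dual_norm0_eq0.

Lemma dual_le_norm (f : dual) (x : X) : `|f x| <= `|f| * `|x|.
Proof. exact: dual_norm_bound. Qed.

Lemma bounded_dual_pred (f : X -> R^o) (M : R) :
  linear f -> (forall x, `|f x| <= M * `|x|) -> f \in dual_pred.
Proof.
move=> lf fM; apply/asboolP; split=> //.
pose F : {linear X -> R^o} := HB.pack f (GRing.isLinear.Build _ _ _ _ f lf).
apply: (@bounded_linear_continuous _ _ _ F); apply/linear_boundedP.
near=> r => x; apply: le_trans (fM x) _; rewrite ler_wpM2r//.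
Unshelve. all: by end_near. Qed.

End Dual.
Arguments dual {R} X.
Arguments dual_pred {R} X.

Section C0.
Context {R : realType}.

Definition c0_pred : {pred nat -> R^o} := fun u => `[< u @ \oo --> (0 : R^o) >].

Record c0 := C0 { c0_fun :> nat -> R^o; _ : c0_fun \in c0_pred }.

HB.instance Definition _ := [isSub for c0_fun].
HB.instance Definition _ := [Choice of c0 by <:].

Lemma c0_submod_closed : submod_closed c0_pred.
Proof.
split; first by apply/asboolP; exact: cvg_cst.
move=> a u v /asboolP u0 /asboolP v0; apply/asboolP.
have -> : (0 : R^o) = a *: (0 : R^o) + 0 by rewrite scaler0 addr0.
by apply: cvgD => //; apply: cvgZl_tmp.
Qed.

HB.instance Definition _ :=
  GRing.isSubmodClosed.Build R (nat -> R^o) c0_pred c0_submod_closed.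
HB.instance Definition _ := [SubChoice_isSubLmodule of c0 by <:].

Lemma c0_cvg (u : c0) : (u : nat -> R^o) @ \oo --> (0 : R^o).
Proof. by case: u => u /= /asboolP. Qed.

Definition c0_norm (u : c0) : R := sup (range (fun n => `|u n|)).

Lemma c0_has_sup (u : c0) : has_sup (range (fun n => `|u n|)).
Proof.
split; first by exists `|u 0%N|, 0%N.
have /cvg_seq_bounded/pinfty_ex_gt0[M M0 uM] :
    cvg ((u : nat -> R^o) @ \oo).
  by apply/cvg_ex; exists 0; exact: c0_cvg.
by exists M => _ [n _ <-]; exact: uM.
Qed.

Lemma c0_coord_le (u : c0) n : `|u n| <= c0_norm u.
Proof. by apply: ub_le_sup; [exact: (c0_has_sup u).2 | exists n]. Qed.

Lemma c0_norm_le (u : c0) (M : R) :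
  (forall n, `|u n| <= M) -> c0_norm u <= M.
Proof.
by move=> uM; apply: ge_sup; [exact: (c0_has_sup u).1 | move=> _ [n _ <-]].
Qed.

Lemma c0_normD (u v : c0) : c0_norm (u + v) <= c0_norm u + c0_norm v.
Proof.
apply: c0_norm_le => n; apply: le_trans (ler_normD _ _) _.
by apply: lerD; exact: c0_coord_le.
Qed.

Lemma c0_normZ_le (l : R) (u : c0) : c0_norm (l *: u) <= `|l| * c0_norm u.
Proof.
by apply: c0_norm_le => n; rewrite normrZ ler_wpM2l//; exact: c0_coord_le.
Qed.

Lemma c0_normZ (l : R) (u : c0) : c0_norm (l *: u) = `|l| * c0_norm u.
Proof.
apply/eqP; rewrite eq_le c0_normZ_le/=.
have [->|l0] := eqVneq l 0.
  by rewrite normr0 mul0r (le_trans (normr_ge0 _) (c0_coord_le _ 0%N)).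
rewrite -ler_pdivlMl ?normr_gt0//.
rewrite -{1}[u]scale1r -(mulVf l0) -scalerA.
by apply: le_trans (c0_normZ_le _ _) _; rewrite normfV.
Qed.

Lemma c0_norm0_eq0 (u : c0) : c0_norm u = 0 -> u = 0.
Proof.
move=> u0; apply/val_inj/funext => n /=; apply/normr0_eq0/eqP.
by rewrite eq_le normr_ge0 andbT -u0 c0_coord_le.
Qed.

HB.instance Definition _ :=
  Lmodule_isNormed.Build R c0 c0_normD c0_normZ c0_norm0_eq0.

Lemma c0_le_norm (u : c0) n : `|u n| <= `|u|.
Proof. exact: c0_coord_le. Qed.

Lemma c0_complete (F : set_system c0) : ProperFilter F -> cauchy F -> cvg F.
Proof.
move=> PF /cauchy_ballP cF.
have cauchyF e : 0 < e ->
    exists2 A, F A & forall x y, A x -> A y -> `|x - y| < e.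
  move=> e0; have [[A B] /= [FA FB] AB] := cF _ e0.
  exists (A `&` B); first exact: filterI.
  move=> x y [Ax _] [_ By]; have := AB (x, y) (conj Ax By).
  by rewrite -ball_normE.
have cvgF n : cvg ((fun x : c0 => x n : R^o) @ F).
  apply: cauchy_cvg; apply/cauchy_ballP => e e0.
  have [A FA Ae] := cauchyF _ e0.
  exists ((fun x : c0 => x n) @` A, (fun x : c0 => x n) @` A) => /=.
    by split; apply: (@filterS _ F _ A) => // x Ax; exists x.
  move=> [_ _] /= [[x Ax <-] [y Ay <-]]; rewrite -ball_normE /=.
  by apply: le_lt_trans (c0_le_norm (x - y) n) (Ae _ _ Ax Ay).
pose l n : R^o := lim ((fun x : c0 => x n : R^o) @ F).
have limF e : 0 < e -> exists2 A, F A &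
    forall x n, A x -> `|x n - l n| <= e.
  move=> e0; have [A FA Ae] := cauchyF _ e0; exists A => // x n Ax.
  have : (fun y : c0 => `|x n - y n|) @ F --> `|x n - l n|.
    by apply: cvg_norm; apply: cvgB; [exact: cvg_cst | exact: cvgF].
  move/cvgr_to_le; apply; apply: filterS FA => y Ay.
  exact: le_trans (c0_le_norm (x - y) n) (ltW (Ae _ _ Ax Ay)).
have l0 : l \in c0_pred.
  apply/asboolP/cvgr0Pnorm_le => e e0.
  have [A FA Ae] := limF _ (divr_gt0 e0 (ltr0n _ 2)).
  have [x Ax] := filter_ex FA.
  have /cvgr0Pnorm_le/(_ _ (divr_gt0 e0 (ltr0n _ 2))) := c0_cvg x.
  apply: filterS => n xn; rewrite -[l n](subrK (x n)) (splitr e).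
  by apply: le_trans (ler_normD _ _) (lerD _ xn); rewrite distrC; exact: Ae.
apply/cvg_ex; exists (C0 l0); apply/cvgrPdist_le => e e0.
have [A FA Ae] := limF _ e0; apply: filterS FA => x Ax.
by apply: c0_norm_le => n; rewrite distrC; exact: Ae.
Qed.

HB.instance Definition _ := Uniform_isComplete.Build c0 c0_complete.

End C0.
Arguments c0 R : clear implicits.
Arguments c0_pred R : clear implicits.


Section Bidual.
Context {R : realType} {X : normedModType R}.

Lemma bidual_embed_subproof (x : X) :
  (fun y : dual X => y x : R^o) \in dual_pred (dual X).
Proof.
by apply: (@bounded_dual_pred _ _ _ `|x|) => // y; rewrite mulrC dual_le_norm.
Qed.

Definition bidual_embed (x : X) : dual (dual X) := Dual (bidual_embed_subproof x).

End Bidual.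

Section Monotone.
Context {R : realType}.

(* Sets in E x F for a bilinear pairing p on E x F: used with (X, X^* ) and with
   (X^**, X^* ). *)
Definition monotone_set {E F : zmodType} (p : E -> F -> R) (S : set (E * F)) :=
  forall z w, S z -> S w -> 0 <= p (z.1 - w.1) (z.2 - w.2).

Definition maximally_monotone {E F : zmodType} (p : E -> F -> R)
    (S : set (E * F)) :=
  monotone_set p S /\ forall T, monotone_set p T -> S `<=` T -> S = T.

Context {X : normedModType R}.

Definition pairing (x : X) (y : dual X) : R := y x.
Definition bipairing (x : dual (dual X)) (y : dual X) : R := x y.

Definition gra (B : X -> set (dual X)) : set (X * dual X) :=
  [set z | B z.1 z.2].

Definition skew_operator (B : X -> set (dual X)) :=
  forall z, gra B z -> pairing z.1 z.2 = 0.

Definition type_BR (B : X -> set (dual X)) :=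
  forall (x : X) (y : dual X) (a b : R), 0 < a -> 0 < b ->
    ((- (a * b))%:E <
     ereal_inf [set (pairing (x - z.1) (y - z.2))%:E | z in gra B])%E ->
    exists z, [/\ gra B z, `|x - z.1| < a & `|y - z.2| < b].

Definition type_unique (B : X -> set (dual X)) :=
  forall S T : set (dual (dual X) * dual X),
    maximally_monotone bipairing S -> maximally_monotone bipairing T ->
    [set (bidual_embed z.1, z.2) | z in gra B] `<=` S ->
    [set (bidual_embed z.1, z.2) | z in gra B] `<=` T ->
    S = T.

Definition directed {I : Type} (le : I -> I -> Prop) :=
  [/\ inhabited I, forall i, le i i,
      forall i j k, le i j -> le j k -> le i k &
      forall i j, exists k, le i k /\ le j k].

(* A net z : I -> T converges to l when z @ tails le --> l. *)
Definition tails {I : Type} (le : I -> I -> Prop) : set_system I :=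
  [set P | exists i, forall j, le i j -> P j].

Definition type_D (B : X -> set (dual X)) :=
  forall (x : dual (dual X)) (y : dual X),
    (0 <= ereal_inf
       [set (bipairing (bidual_embed z.1 - x) (z.2 - y))%:E | z in gra B])%E ->
    exists (I : Type) (le : I -> I -> Prop) (z : I -> X * dual X),
      [/\ directed le, forall i, gra B (z i), bounded_fun z,
          forall f : dual X, bidual_embed (z i).1 f @[i --> tails le] --> x f &
          (z i).2 @[i --> tails le] --> y].

End Monotone.

Definition space_type_D {R : realType} (X : completeNormedModType R) :=
  forall B : X -> set (dual X),
    maximally_monotone pairing (gra B) -> type_D B.

(* A linear map bounded above and below is an isomorphism onto its range. *)
Definition contains_copy {R : realType} (Z X : normedModType R) :=
  exists (T : {linear Z -> X}) (m M : R),
    0 < m /\ forall z, m * `|z| <= `|T z| <= M * `|z|.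

Section C0Dual.
Context {R : realType}.

Lemma c0_basis_subproof n : (fun k => (k == n)%:R : R^o) \in c0_pred R.
Proof.
apply/asboolP; apply: cvg_near_cst; exists n.+1 => // k /= nk.
by rewrite (gtn_eqF nk).
Qed.

Definition e_ n : c0 R := C0 (c0_basis_subproof n).

Lemma c0_sumE (N : nat) (a : nat -> R) k :
  (\sum_(n < N) a n *: e_ n) k = if (k < N)%N then a k else 0.
Proof.
have -> : (\sum_(n < N) a n *: e_ n) k = \sum_(n < N) a n * (k == n)%:R.
  by rewrite (big_morph (fun u : c0 R => u k : R) (id1 := 0) (op1 := +%R)).
case: ltnP => kN.
  rewrite (bigD1 (Ordinal kN)) //= eqxx mulr1 big1 ?addr0// => i /negPf ik.
  by rewrite [k == _]eq_sym -[i == k :> nat]/(i == Ordinal kN) ik mulr0.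
by rewrite big1 // => i _; rewrite gtn_eqF ?mulr0 // (leq_trans _ kN).
Qed.

Lemma c0_dual_sum_le (y : dual (c0 R)) N :
  \sum_(n < N) `|y (e_ n)| <= `|y|.
Proof.
pose x : c0 R := \sum_(n < N) Num.sg (y (e_ n)) *: e_ n.
have -> : \sum_(n < N) `|y (e_ n)| = y x.
  by rewrite linear_sum; apply: eq_bigr => n _; rewrite linearZ /= normrEsg.
apply: le_trans (ler_norm _) _; apply: le_trans (dual_le_norm _ _) _.
rewrite ler_piMr//; apply: c0_norm_le => k.
have -> : x k = _ := c0_sumE N (fun n => Num.sg (y (e_ n))) k.
by case: ifP => _; rewrite ?normr0// normr_sg; case: (_ != 0).
Qed.

Lemma linf_cvg (u : nat -> R) (M : R) (y : dual (c0 R)) :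
  (forall n, `|u n| <= M) ->
  cvgn (series (fun n => u n * y (e_ n))) /\
  `|limn (series (fun n => u n * y (e_ n)))| <= M * `|y|.
Proof.
move=> uM; have M0 : 0 <= M := le_trans (normr_ge0 _) (uM 0%N).
have leM N : [normed series (fun n => u n * y (e_ n))] N <= M * `|y|.
  rewrite /normed_series_of /series /= big_mkord.
  apply: le_trans (_ : _ <= M * \sum_(n < N) `|y (e_ n)|) _.
    by rewrite mulr_sumr; apply: ler_sum => n _; rewrite normrM ler_wpM2r.
  by rewrite ler_wpM2l// c0_dual_sum_le.
have nc : cvgn [normed series (fun n => u n * y (e_ n))].
  apply: nondecreasing_is_cvgn; last by exists (M * `|y|) => _ [N _ <-].
  by apply/nondecreasing_seqP => n; rewrite /= /series /= big_nat_recr//= lerDl.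
split; first exact: normed_cvg.
by apply: le_trans (lim_series_norm nc) _; apply: limr_le => //; exact: nearW.
Qed.

Lemma linf_subproof (u : nat -> R) : bounded_fun u ->
  (fun y : dual (c0 R) => limn (series (fun n => u n * y (e_ n))) : R^o)
    \in dual_pred (dual (c0 R)).
Proof.
move=> /pinfty_ex_gt0[M M0 uM].
have uM' n : `|u n| <= M by exact: uM.
apply: (@bounded_dual_pred _ _ _ M) => [a y z|y]; last exact: (linf_cvg y uM').2.
have [cy _] := linf_cvg y uM'; have [cz _] := linf_cvg z uM'.
rewrite -lim_seriesZ // -lim_seriesD //; last exact: is_cvg_seriesZ.
congr (limn (series _)); apply/funext => n.
have -> : (a *: y + z) (e_ n) = a * y (e_ n) + z (e_ n) by [].
by rewrite mulrDr mulrCA.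
Qed.

(* The element of c_0^** = l^oo given by a bounded sequence. *)
Definition linf (u : nat -> R) (bu : bounded_fun u) : dual (dual (c0 R)) :=
  Dual (linf_subproof bu).

Lemma bounded_cst1 : bounded_fun (fun _ : nat => 1 : R).
Proof. by exists 1; split=> // M M1 n _; rewrite normr1 ltW. Qed.

Definition ones : dual (dual (c0 R)) := linf bounded_cst1.

(* dual (c0 R) is l^1 through the coordinates y (e_ n): they determine y
   (dual_c0_cvg), are summable (c0_dual_sum_le) and arbitrary such (l1_dual).
   linf extends the canonical embedding (bidual_embed_linf). *)
Lemma c0_basis_cvg (x : c0 R) : series (fun n => x n *: e_ n) @ \oo --> x.
Proof.
apply/cvgrPdist_le => e e0.
have /cvgr0Pnorm_le/(_ _ e0)[N _ xN] := c0_cvg x.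
exists N => // m /= Nm; apply: c0_norm_le => k; rewrite /series /= big_mkord.
suff : `|x k - (\sum_(n < m) x n *: e_ n) k| <= e by [].
rewrite c0_sumE; case: ltnP => km; first by rewrite subrr normr0 ltW.
by rewrite subr0; apply: xN; exact: leq_trans km.
Qed.

Lemma dual_c0_cvg (y : dual (c0 R)) (x : c0 R) :
  series (fun n => x n * y (e_ n)) @ \oo --> (y x : R^o).
Proof.
have := cvg_comp _ _ (c0_basis_cvg (x := x)) (@dual_continuous _ _ y x).
apply: cvg_trans; apply: near_eq_cvg; apply: nearW => N.
rewrite /series /= linear_sum; apply: eq_bigr => n _.
by rewrite linearZ.
Qed.

Lemma bidual_embed_linf (x : c0 R) (bx : bounded_fun (x : nat -> R)) :
  bidual_embed x = linf bx.
Proof.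
apply/val_inj/funext => y /=; apply/esym/cvg_lim => //; exact: dual_c0_cvg.
Qed.

Lemma l1_dual (u : nat -> R^o) : cvgn [normed series u] ->
  exists y : dual (c0 R), forall n, y (e_ n) = u n.
Proof.
move=> cu; pose S := limn [normed series u].
have leS N : \sum_(0 <= n < N) `|u n| <= S.
  apply: (@nondecreasing_cvgn_le _ [normed series u]) => //.
  by apply/nondecreasing_seqP => n; rewrite /= /series /= big_nat_recr//= lerDl.
have cx (x : c0 R) : cvgn (series (fun n => x n * u n : R^o)) /\
    `|limn (series (fun n => x n * u n : R^o))| <= S * `|x|.
  have leM N : [normed series (fun n => x n * u n : R^o)] N <= S * `|x|.
    rewrite /normed_series_of /series /=.
    apply: le_trans (_ : _ <= `|x| * \sum_(0 <= n < N) `|u n|) _.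
      rewrite mulr_sumr; apply: ler_sum => n _; rewrite normrM ler_wpM2r//.
      exact: c0_le_norm.
    by rewrite mulrC ler_wpM2r.
  have nc : cvgn [normed series (fun n => x n * u n : R^o)].
    apply: nondecreasing_is_cvgn; last by exists (S * `|x|) => _ [N _ <-].
    by apply/nondecreasing_seqP => n; rewrite /= /series /= big_nat_recr//= lerDl.
  split; first exact: normed_cvg.
  by apply: le_trans (lim_series_norm nc) _; apply: limr_le => //; exact: nearW.
have yP : (fun x : c0 R => limn (series (fun n => x n * u n : R^o)) : R^o)
    \in dual_pred (c0 R).
  apply: (@bounded_dual_pred _ _ _ S) => [a x z|x]; last exact: (cx x).2.
  have [cX _] := cx x; have [cZ _] := cx z.
  rewrite -lim_seriesZ // -lim_seriesD //; last exact: is_cvg_seriesZ.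
  congr (limn (series _)); apply/funext => n.
  have -> : (a *: x + z) n = a * x n + z n by [].
  by rewrite mulrDl -mulrA.
exists (Dual yP) => n /=; apply/cvg_lim => //; apply: cvg_near_cst.
exists n.+1 => // N /= nN; rewrite /series /= big_mkord.
rewrite (bigD1 (Ordinal nN)) //= eqxx mul1r big1 ?addr0// => i /negPf ik.
by rewrite -[i == n :> nat]/(i == Ordinal nN) ik mul0r.
Qed.

Definition perp (X : normedModType R) (f : dual (dual X)) : set (dual X) :=
  [set y | bipairing f y = 0].

(* The sums over i > n converge since the coordinates of y are
   summable; coordinates are numbered from 0. *)
Definition A (x : c0 R) : set (dual (c0 R)) :=
  [set y | perp ones y /\
    series (fun n => (- (\big[+%R/0]_(n.+1 <= i <oo) y (e_ i))
                      + \sum_(i < n) y (e_ i)) *: e_ n) @ \oo --> x].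

(* Gossez's operator from l^1 to l^oo. *)
Definition G (y : dual (c0 R)) : nat -> R^o :=
  fun n => \big[+%R/0]_(n.+1 <= i <oo) y (e_ i) - \sum_(i < n) y (e_ i).

Definition T_e (x : c0 R) : set (dual (c0 R)) :=
  [set y | (x : nat -> R^o) = - G y /\ bipairing ones y = 0].

End C0Dual.
Arguments A R : clear implicits.
Arguments T_e R : clear implicits.

(* Main.v *)
Require Import Defs.
From mathcomp Require Import all_boot all_order all_algebra.
From mathcomp Require Import all_classical all_reals all_analysis.
From mathcomp Require Import ring lra.
Import Order.TTheory GRing.Theory Num.Theory.
Import numFieldNormedType.Exports.
Local Open Scope classical_set_scope.
Local Open Scope ring_scope.

(** Everything rests on the partial sums [S_n = y_0 + ... + y_(n-1)] of
    a summable sequence [y].  If [y] has sum zero, the tail beyond [n] is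
    [- S_(n+1)], so the graph of [A] consists of the pairs with
    [x_n = S_n + S_(n+1)] ([graAP]).  As [y_n = S_(n+1) - S_n], the pairing of
    [x] and [y] telescopes to the limit of [S_N ^ 2], which is [0]: [A] is
    skew ([A_skew]).  Two more facts suffice for all the rest: [x_0 = y_0] on
    the graph ([A_coord0]), and a functional on l^1 that kills the sequences
    of sum zero is a multiple of [ones] ([perp_annihilator]).

    For a skew linear graph [S], a point [z] is monotonically related to [S]
    exactly when the pairing is nonnegative at [z] and [z] is orthogonal to
    [S] for the polarized form ([skew_related]).  Write [d] for the unit
    vector of index 0 in l^1.  Splitting [y] into [t d] plus a sequence [b] of
    sum zero, with [a] in c_0 such that [(a, b)] lies in the graph, such a [z]
    must be [(a - t e_0, b + t d)], where the pairing is [- t ^ 2]; hence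
    [t = 0] and [A] is maximal ([A_maximal]).

    The other claims come from explicit points.
    - At [(- e_0, d)] the difference with any point of the graph has pairing
      [-1], although [d] is at distance at least [1] from the range of [A];
      this contradicts type (BR) for the radii [2] and [1].
    - Adding to the graph of [A] the line through [(ones, 0)], or the line
      through [(ones - e_0, d)], gives two different skew subspaces
      that are both maximal in the bidual setting: [A] is not unique.
    - The point [(ones - e_0, d)] is monotonically related to the graph, but
      no net in the range of [A] converges to [d], because [ones] vanishes on
      the range and is [1] at [d]: [A] is not of type (D).

    Now let [T] embed c_0 in a Banach space [X].  The functionals [f] on [X]
    such that [f \o T] belongs to [A z], placed over the point [T z], form the
    graph of an operator on [X].  By the Hahn-Banach theorem ([hahn_banach])
    every functional on c_0 has the form [f \o T], and [X] has enough
    functionals vanishing on the closed range of [T] to force any point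
    related to that graph to lie over this range; so the operator is maximally
    monotone ([lift_maximal]).  The last point above, pushed to the bidual of
    [X], shows that it is not of type (D) ([lift_not_type_D]). *)

(** * Skew subspaces and maximal monotonicity *)

Section SkewSubspaces.
Context {R : realType} {U V : lmodType R} (p : U -> V -> R).
Hypothesis pDl : forall a u u' v, p (a *: u + u') v = a * p u v + p u' v.
Hypothesis pDr : forall a u v v', p u (a *: v + v') = a * p u v + p u v'.

Lemma bil0l v : p 0 v = 0.
Proof. by have := pDl 1 0 0 v; rewrite scaler0 addr0; lra. Qed.

Lemma bil0r u : p u 0 = 0.
Proof. by have := pDr 1 u 0 0; rewrite scaler0 addr0; lra. Qed.

Lemma bilZl a u v : p (a *: u) v = a * p u v.
Proof. by have := pDl a u 0 v; rewrite addr0 bil0l addr0. Qed.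

Lemma bilZr a u v : p u (a *: v) = a * p u v.
Proof. by have := pDr a u v 0; rewrite addr0 bil0r addr0. Qed.

Lemma bilBl u u' v : p (u - u') v = p u v - p u' v.
Proof. by have := pDl (-1) u' u v; rewrite scaleN1r addrC => ->; ring. Qed.

Lemma bilBr u v v' : p u (v - v') = p u v - p u v'.
Proof. by have := pDr (-1) u v' v; rewrite scaleN1r addrC => ->; ring. Qed.

Lemma bil_sub u u' v v' :
  p (u - u') (v - v') = p u v - (p u v' + p u' v) + p u' v'.
Proof. by rewrite bilBl !bilBr; ring. Qed.

Lemma bil_sub_swap u u' v v' : p (u - u') (v - v') = p (u' - u) (v' - v).
Proof. by rewrite !bil_sub; ring. Qed.

(** Adjoining [z] to [S] would otherwise give a proper monotone extension. *)
Lemma maximal_related (S : set (U * V)) z : maximally_monotone p S ->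
  (forall w, S w -> 0 <= p (z.1 - w.1) (z.2 - w.2)) -> S z.
Proof.
move=> [mS maxS] rel; rewrite (maxS (z |` S)); first by left.
  move=> a b [->|Sa] [->|Sb]; [|exact: rel| |exact: mS].
    by rewrite !subrr bil0l.
  by rewrite bil_sub_swap; exact: rel.
by move=> w Sw; right.
Qed.

Lemma maximal_nonempty (S : set (U * V)) : maximally_monotone p S -> S !=set0.
Proof.
move=> maxS; apply: contrapT => S0; apply: (S0); exists 0.
by apply: maximal_related maxS _ => w Sw; case: S0; exists w.
Qed.

Lemma affine_ge0_slope0 (c d : R) : (forall t, 0 <= c - t * d) -> d = 0.
Proof.
move=> h; apply/eqP/negP => /negP d0.
by have := h ((c + 1) / d); rewrite divfK//; lra.
Qed.

Variable S : set (U * V).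
Hypothesis S0 : S 0.
Hypothesis Slin : forall a z w, S z -> S w -> S (a *: z + w).
Hypothesis Sskew : forall z, S z -> p z.1 z.2 = 0.

Lemma skew_polar z w : S z -> S w -> p z.1 w.2 + p w.1 z.2 = 0.
Proof.
move=> Sz Sw; have := Sskew _ (Slin (-1) _ _ Sw Sz).
rewrite addrC scaleN1r /= bil_sub (Sskew z Sz) (Sskew w Sw); lra.
Qed.

Lemma skew_monotone : monotone_set p S.
Proof.
move=> z w Sz Sw; rewrite bil_sub (Sskew z Sz) (Sskew w Sw) skew_polar//; lra.
Qed.

(** Along the line through [w] the pairing of the difference is an affine
    function of the parameter, so nonnegativity forces its slope to vanish. *)
Lemma skew_related z :
  (forall w, S w -> 0 <= p (z.1 - w.1) (z.2 - w.2)) ->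
  0 <= p z.1 z.2 /\ forall w, S w -> p z.1 w.2 + p w.1 z.2 = 0.
Proof.
move=> h; split; first by have := h _ S0; rewrite !subr0.
move=> w Sw; apply: (@affine_ge0_slope0 (p z.1 z.2)) => t.
have := h _ (Slin t _ _ Sw S0).
by rewrite addr0 bil_sub /= bilZr !bilZl bilZr (Sskew w Sw); lra.
Qed.

Lemma skew_maximal :
  (forall z, 0 <= p z.1 z.2 ->
    (forall w, S w -> p z.1 w.2 + p w.1 z.2 = 0) -> S z) ->
  maximally_monotone p S.
Proof.
move=> h; split; first exact: skew_monotone.
move=> T mT ST; apply/seteqP; split=> // z Tz.
have [] := @skew_related z; first by move=> w /ST; exact: mT.
exact: h.
Qed.

(** A point orthogonal to [S] differs from the point of [S] with the same
    second component by some [(u, 0)], and [u] then annihilates the whole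
    range, that is, everything. *)
Lemma skew_full_range_maximal :
  (forall u, (forall v, p u v = 0) -> u = 0) ->
  (forall v, exists u, S (u, v)) -> maximally_monotone p S.
Proof.
move=> nd full; apply: skew_maximal => -[u v] _ h.
have [a Sa] := full v.
suff -> : u = a by [].
apply/eqP; rewrite -subr_eq0; apply/eqP/nd => v'.
have [b Sb] := full v'.
have /= := h _ Sb; have /= := skew_polar _ _ Sa Sb.
rewrite bilBl; lra.
Qed.

End SkewSubspaces.

Section Pairings.
Context {R : realType} {X : normedModType R}.

Lemma pairingDl (a : R) (x x' : X) (f : dual X) :
  pairing (a *: x + x') f = a * pairing x f + pairing x' f.
Proof. by rewrite /pairing linearP. Qed.

Lemma pairingDr (a : R) (x : X) (f f' : dual X) :
  pairing x (a *: f + f') = a * pairing x f + pairing x f'.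
Proof. by []. Qed.

Lemma bipairingDl (a : R) (F F' : dual (dual X)) (f : dual X) :
  bipairing (a *: F + F') f = a * bipairing F f + bipairing F' f.
Proof. by []. Qed.

Lemma bipairingDr (a : R) (F : dual (dual X)) (f f' : dual X) :
  bipairing F (a *: f + f') = a * bipairing F f + bipairing F f'.
Proof. by rewrite /bipairing linearP. Qed.

End Pairings.

(** * Hahn-Banach extension along a linear map *)

Section HahnBanach.
Context {R : realType} {X : normedModType R}.

(** Graphs of linear functionals defined on a subspace and bounded by [C] times
    the norm; applied to [(0, r)] and [(0, - r)] the bound makes the relation
    single-valued. *)
Definition dominated_subspace (C : R) (S : set (X * R)) :=
  (forall a z w, S z -> S w -> S (a *: z.1 + w.1, a * z.2 + w.2)) /\
  forall z, S z -> z.2 <= C * `|z.1|.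

(** The value [c] at [v] has to lie above every [s - C |u - v|] and below every
    [C |u' + v| - s'], for [(u, s)] and [(u', s')] in [S]; the triangle
    inequality puts the former below the latter, and [c] is the supremum of
    the former. *)
Lemma dominated_extend_one (C : R) (S : set (X * R)) (v : X) :
  0 <= C -> S (0, 0) -> dominated_subspace C S ->
  exists c, dominated_subspace C
    [set z | exists w t, S w /\ z = (w.1 + t *: v, w.2 + t * c)].
Proof.
move=> C0 S0 [Slin Sdom].
pose L := [set w.2 - C * `|w.1 - v| | w in S].
have Lub w : S w -> ubound L (C * `|w.1 + v| - w.2).
  move=> Sw _ [u Su <-].
  have := Sdom _ (Slin 1 _ _ Su Sw); rewrite /= scale1r mul1r.
  have : `|u.1 + w.1| <= `|u.1 - v| + `|w.1 + v|.
    rewrite (le_trans _ (ler_normD _ _))//.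
    by rewrite addrACA addNr addr0.
  move=> /(ler_wpM2l C0); lra.
have hL : has_sup L.
  split; first by exists (0 - C * `|0 - v|), (0, 0).
  by exists (C * `|0 + v| - 0); exact: Lub S0.
exists (sup L); split.
  move=> a _ _ [w [t [Sw ->]]] [w' [t' [Sw' ->]]].
  exists (a *: w.1 + w'.1, a * w.2 + w'.2), (a * t + t'); split.
    exact: Slin.
  congr pair; rewrite /=; last by ring.
  by rewrite scalerDr scalerDl addrACA scalerA.
move=> _ [w [t [Sw ->]]] /=.
have SZ a : S (a *: w.1, a * w.2).
  by have := Slin a _ _ Sw S0; rewrite !addr0.
have [t0|t0|->] := ltgtP t 0.
(* For negative or positive [t], the bound is a lower or upper constraint on
   [c], rescaled by the absolute value of [t]. *)
- have /(ub_le_sup hL.2) : L ((- t)^-1 * w.2 - C * `|(- t)^-1 *: w.1 - v|).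
    by exists ((- t)^-1 *: w.1, (- t)^-1 * w.2).
  have -> : w.1 + t *: v = (- t) *: ((- t)^-1 *: w.1 - v).
    by rewrite scalerBr scalerA divff ?oppr_eq0 ?lt_eqF// scale1r scaleNr opprK.
  rewrite normrZ gtr0_norm ?oppr_gt0//.
  set N := `|_|; have t1 : 0 < - t by rewrite oppr_gt0.
  move=> /(ler_wpM2l (ltW t1)); rewrite mulrBr mulrA divff ?gt_eqF// mul1r.
  by lra.
- have /(ge_sup hL.1) := Lub _ (SZ t^-1).
  have -> : w.1 + t *: v = t *: (t^-1 *: w.1 + v).
    by rewrite scalerDr scalerA divff ?gt_eqF// scale1r.
  rewrite normrZ gtr0_norm//= ; set N := `|_|.
  move=> /(ler_wpM2l (ltW t0)); rewrite mulrBr [t * (t^-1 * _)]mulrA.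
  rewrite divff ?gt_eqF// mul1r; lra.
- by rewrite scale0r mul0r !addr0; exact: Sdom.
Qed.

(** Bounding [g] through [T] makes [T z |-> g z] a well-defined bounded
    functional on the range of [T], even if [T] has a kernel.  This form gives
    both the extension of functionals along an embedding and, with a suitable
    [T], the separation of a point from a closed subspace. *)
Lemma hahn_banach (Z : lmodType R) (T : Z -> X) (g : Z -> R^o) (C : R) :
  linear T -> linear g -> 0 <= C -> (forall z, `|g z| <= C * `|T z|) ->
  exists f : dual X, forall z, f (T z) = g z.
Proof.
move=> lT lg C0 gC.
pose G0 : set (X * R) := range (fun z => (T z, g z : R)).
(* Containing [G0] is required of nonempty graphs only, since the union of the
   empty chain has to qualify. *)
pose P S := (S !=set0 -> G0 `<=` S) /\ dominated_subspace C S.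
have G00 : G0 (0, 0).
  exists 0 => //.
  have := lT (-1) 0 0; have := lg (-1) 0 0.
  by rewrite !scaleN1r !addNr => -> ->.
have PG0 : P G0.
  split; first by move=> _ z.
  split=> [a _ _ [z _ <-] [w _ <-]|_ [z _ <-]] /=.
    by exists (a *: z + w) => //; rewrite lT lg.
  exact: le_trans (ler_norm _) (gC z).
have [|S [[G0S Sdom] Smax]] := @Zorn_bigcup _ P.
  move=> F FP Ftot; split.
    move=> [z [A FA Az]] w G0w; exists A => //.
    exact: (FP A FA).1 (ex_intro _ z Az) w G0w.
  split=> [a z w [A FA Az] [B FB Bw]|z [A FA Az]]; last exact: (FP A FA).2.2.
  have [AB|BA] := Ftot _ _ FA FB.
    by exists B => //; apply: (FP B FB).2.1 => //; exact: AB.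
  by exists A => //; apply: (FP A FA).2.1 => //; exact: BA.
have {}G0S : G0 `<=` S.
  apply: G0S; apply: contrapT => S0; apply: (Smax G0) => //; split.
    by move=> z Sz; case: S0; exists z.
  by move=> /(_ _ G00) z; case: S0; exists (0, 0).
have S0 : S (0, 0) := G0S _ G00.
have full v : exists r, S (v, r).
  have [c Ddom] := dominated_extend_one C S v C0 S0 Sdom.
  set D := [set z | _] in Ddom.
  have SD : S `<=` D.
    by move=> [x r] Sx; exists (x, r), 0; rewrite /= scale0r mul0r !addr0.
  have Dv : D (v, c).
    by exists (0, 0), 1; split=> //=; rewrite scale1r mul1r !add0r.
  apply: contrapT => nS; apply: (Smax D); last first.
    by split=> // _ w /G0S /SD.
  by split=> // /(_ _ Dv) Sv; apply: nS; exists c.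
have Sfun v r s : S (v, r) -> S (v, s) -> r = s.
  move=> Sr Ss.
  have := Sdom.2 _ (Sdom.1 (-1) _ _ Sr Ss).
  have := Sdom.2 _ (Sdom.1 (-1) _ _ Ss Sr).
  rewrite /= scaleN1r addNr normr0; lra.
pose f v : R^o := sval (cid (full v)).
have fS v : S (v, f v) := svalP (cid (full v)).
have lf : linear f.
  by move=> a u v; apply: Sfun (fS _) (Sdom.1 a _ _ (fS u) (fS v)).
have fC v : `|f v| <= C * `|v|.
  rewrite ler_norml; apply/andP; split; last exact: Sdom.2 _ (fS v).
  have := Sdom.2 _ (Sdom.1 (-1) _ _ (fS v) S0).
  by rewrite /= !addr0 scaleN1r normrN; lra.
exists (Dual (bounded_dual_pred lf fC)) => z /=.
by apply: Sfun (fS _) _; apply: G0S; exists z.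
Qed.

End HahnBanach.

(** * Lifting an operator along an embedding *)

Section Lift.
Context {R : realType} {Z X : normedModType R} (T : {linear Z -> X}) (M : R).
Hypothesis TM : forall z, `|T z| <= M * `|z|.

Lemma pullback_subproof (f : dual X) : (fun z => f (T z) : R^o) \in dual_pred Z.
Proof.
apply: (@bounded_dual_pred _ _ _ (`|f| * M)) => [a u v|z].
  by rewrite !linearP.
by rewrite (le_trans (dual_le_norm _ _))// -mulrA ler_wpM2l.
Qed.

(** The adjoint of [T]. *)
Definition pullback (f : dual X) : dual Z := Dual (pullback_subproof f).

Lemma pullbackP a f g : pullback (a *: f + g) = a *: pullback f + pullback g.
Proof. exact/val_inj. Qed.

Lemma pullback_norm f : 0 <= M -> `|pullback f| <= M * `|f|.
Proof.
move=> M0; apply: dual_norm_le => z z1 /=.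
rewrite (le_trans (dual_le_norm _ _))// mulrC ler_wpM2r//.
by rewrite (le_trans (TM z))// ler_piMr.
Qed.

Lemma push_bidual_subproof (F : dual (dual Z)) :
  (fun f => F (pullback f) : R^o) \in dual_pred (dual X).
Proof.
apply: (@bounded_dual_pred _ _ _ (`|F| * `|M|)) => [a f g|f].
  by rewrite pullbackP linearP.
rewrite (le_trans (dual_le_norm _ _))// -mulrA ler_wpM2l//.
have [M0|M0] := leP 0 M; first by rewrite ger0_norm// pullback_norm.
have T0 z : T z = 0.
  apply/eqP; rewrite -normr_le0 (le_trans (TM z))// mulr_le0_ge0// ltW//.
suff -> : pullback f = 0 by rewrite normr0 mulr_ge0.
by apply/val_inj/funext => z /=; rewrite T0 linear0.
Qed.

(** The second adjoint of [T]. *)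
Definition push_bidual (F : dual (dual Z)) : dual (dual X) :=
  Dual (push_bidual_subproof F).

Definition operator_lift (B : Z -> set (dual Z)) (x : X) : set (dual X) :=
  [set f | exists2 z, x = T z & B z (pullback f)].

(** The functional [u] separates [pullback f] from the range of [B], which
    already prevents the second components of a net from converging to [f]. *)
Lemma lift_not_type_D (B : Z -> set (dual Z)) (F : dual (dual Z)) (f : dual X)
    (u : dual (dual Z)) :
  (forall z, gra B z ->
     0 <= bipairing (bidual_embed z.1 - F) (z.2 - pullback f)) ->
  (forall z, gra B z -> u z.2 = 0) -> u (pullback f) != 0 ->
  ~ type_D (operator_lift B).
Proof.
move=> rel u0 uf /(_ (push_bidual F) f)[|I [le [w [dir wB _ _ wf]]]].
  apply: le_ereal_inf_tmp => _ [[x g] [z /= -> Bz] <-]; rewrite lee_fin.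
  apply: le_trans (rel (z, pullback g) Bz) _.
  rewrite /bipairing /=.
  have -> : pullback g - pullback f = pullback (g - f) by exact/val_inj.
  by [].
have [[i0] le_refl le_trans_ le_dir] := dir.
have FF : ProperFilter (tails le).
  split; first by move=> [i /(_ i (le_refl i))].
  split; first by exists i0.
    move=> P Q [i iP] [j jQ]; have [k [ik jk]] := le_dir i j.
    exists k => l kl; split; first exact: iP (le_trans_ _ _ _ ik kl).
    exact: jQ (le_trans_ _ _ _ jk kl).
  by move=> P Q PQ [i iP]; exists i => j ij; exact/PQ/iP.
move/eqP: uf; apply.
have := cvg_comp _ _ wf (@dual_continuous _ _ (push_bidual u) f).
have -> : push_bidual u \o (fun i => (w i).2) = cst 0.
  apply/funext => i; have [z _ Bz] := wB i.
  exact: (u0 (z, pullback (w i).2) Bz).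
move=> uf0; apply: (cvg_unique _ uf0) => //; exact: cvg_cst.
Qed.

End Lift.

Section LiftMaximal.
Context {R : realType} {Z X : completeNormedModType R} (T : {linear Z -> X}).
Variables m M : R.
Hypothesis m0 : 0 < m.
Hypothesis mT : forall z, m * `|z| <= `|T z|.
Hypothesis TM : forall z, `|T z| <= M * `|z|.

Lemma pullback_surjective (g : dual Z) :
  exists f : dual X, pullback T M TM f = g.
Proof.
have [||||f fg] := @hahn_banach R X Z T g (`|g| / m).
- by move=> a u v; rewrite linearP.
- by move=> a u v; rewrite linearP.
- by rewrite divr_ge0// ltW.
- move=> z; rewrite (le_trans (dual_le_norm _ _))// -mulrA ler_wpM2l//.
  by rewrite ler_pdivlMl.
by exists f; apply/val_inj/funext => z; exact: fg.
Qed.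

(** Otherwise [x] is a limit of points [T (z n)]; as [T] is bounded below the
    [z n] form a Cauchy sequence, and [T] maps its limit to [x]. *)
Lemma range_dist_gt0 (x : X) : ~ range T x ->
  exists2 d, 0 < d & forall z, d <= `|T z - x|.
Proof.
move=> Tx; apply: contrapT => nd.
have h n : exists z, `|T z - x| < n.+1%:R^-1.
  apply: contrapT => nz; apply: nd; exists n.+1%:R^-1.
    by rewrite invr_gt0.
  by move=> z; rewrite leNgt; apply/negP => lz; apply: nz; exists z.
pose z n := sval (cid (h n)).
have zP n : `|T (z n) - x| < n.+1%:R^-1 := svalP (cid (h n)).
have Tzx : T \o z @ \oo --> x.
  apply/cvgrPdist_lt => e e0; near=> n; rewrite distrC (lt_trans (zP n))//.
  near: n; exact: near_infty_natSinv_lt (PosNum e0).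
have zc : cvgn z.
  apply/cauchy_cvgP/cauchy_exP => e e0.
  have /cvgrPdist_lt/(_ (m * e / 2)) := Tzx.
  move=> /(_ (divr_gt0 (mulr_gt0 m0 e0) (ltr0n _ 2))).
  case=> N _ hN; exists (z N), N => // k /= Nk.
  rewrite -ball_normE /= -(ltr_pM2l m0); apply: le_lt_trans (mT _) _.
  have /= h1 := hN N (leqnn N); have /= h2 := hN k Nk.
  rewrite linearB /= [ltRHS]splitr -(subrKA x).
  by rewrite (le_lt_trans (ler_normD _ _))// ltrD// distrC.
have cT : continuous T.
  apply: bounded_linear_continuous; apply/linear_boundedP.
  by near=> r => u; rewrite (le_trans (TM u))// ler_wpM2r//.
apply: Tx; exists (lim (z @ \oo)) => //.
exact: (cvg_unique _ (cvg_comp _ _ zc (cT _)) Tzx).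
Unshelve. all: by end_near. Qed.

(** Extension of [(z, t) |-> t] along [(z, t) |-> T z + t x], which is possible
    because [|T z + t x|] is at least [|t|] times the distance from [x] to the
    range of [T]. *)
Lemma range_separation (x : X) : ~ range T x ->
  exists2 k : dual X, (forall z, k (T z) = 0) & k x = 1.
Proof.
move=> /range_dist_gt0[d d0 Td].
have [||||k kP] := @hahn_banach R X (Z * R^o)%type
  (fun u => T u.1 + u.2 *: x) snd d^-1.
- by move=> a u v /=; rewrite linearP scalerDl scalerDr scalerA addrACA.
- by [].
- by rewrite invr_ge0 ltW.
- move=> [z t] /=; rewrite ler_pdivlMl//.
  have [->|t0] := eqVneq t 0; first by rewrite normr0 mulr0.
  have -> : T z + t *: x = (- t) *: (T (- t^-1 *: z) - x).
    by rewrite linearZ /= scalerBr scalerA mulrNN divff// scale1r scaleNr opprK.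
  by rewrite normrZ normrN mulrC ler_wpM2l.
exists k => [z|].
  by have /= := kP (z, 0); rewrite scale0r addr0.
by have /= := kP (0, 1); rewrite linear0 scale1r add0r.
Qed.

(** The graph of the lift contains, with any [(T z, f)], all [(T z, f + k)] with
    [k] vanishing on the range of [T].  A point [(x, f)] related to all of them
    satisfies [k x = 0] for all such [k], so [x = T w] for some [w], and the
    maximality of [B] applies to [(w, pullback f)]. *)
Lemma lift_maximal (B : Z -> set (dual Z)) :
  maximally_monotone pairing (gra B) ->
  maximally_monotone pairing (gra (operator_lift T M TM B)).
Proof.
move=> maxB; split.
  move=> [x f] [y g] [z /= -> Bz] [w /= -> Bw]; rewrite /= -linearB.
  exact: maxB.1 (z, _) (w, _) Bz Bw.
move=> S mS BS; apply/seteqP; split=> // -[x f] Sxf.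
have [[w _ wx]|/range_separation[k kT kx]] := pselect (range T x).
  exists w => //; apply: (maximal_related pairing pairingDl pairingDr _
    (w, pullback T M TM f) maxB) => z Bz.
  have [g gE] := pullback_surjective z.2.
  have : 0 <= pairing (x - T z.1) (f - g).
    by apply: mS (x, f) (T z.1, g) Sxf _; apply: BS; exists z.1; rewrite //= gE.
  by rewrite -wx -linearB -gE.
have [[z0 g0] Bz0] := maximal_nonempty pairing pairingDl pairingDr _ maxB.
have [g0' g0E] := pullback_surjective g0.
suff : k (x - T z0) = 0.
  by rewrite linearB /= kT kx subr0 => /eqP; rewrite oner_eq0.
apply: (@affine_ge0_slope0 _ (pairing (x - T z0) (f - g0'))) => t.
have := mS (x, f) (T z0, g0' + t *: k) Sxf; rewrite /pairing /=.
rewrite opprD addrA; apply; apply: BS; exists z0 => //=.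
have -> : pullback T M TM (g0' + t *: k) = g0; last exact: Bz0.
rewrite addrC pullbackP g0E -[RHS]add0r; congr (_ + _).
by apply/val_inj/funext => z /=; rewrite -[LHS]/(t * k (T z)) kT mulr0.
Qed.

End LiftMaximal.

(** * Gossez's operator in terms of partial sums *)

Section GossezOperator.
Context {R : realType}.
Implicit Types (x : c0 R) (y : dual (c0 R)).

Lemma dual_basis_subproof n : (fun x : c0 R => x n : R^o) \in dual_pred (c0 R).
Proof.
apply: (@bounded_dual_pred _ _ _ 1) => // x; rewrite mul1r.
exact: c0_le_norm.
Qed.

(** The unit vectors of l^1, as functionals on c_0. *)
Definition dual_basis n : dual (c0 R) := Dual (dual_basis_subproof n).

Definition psum y n : R := \sum_(i < n) y (e_ i).

Lemma psumS y n : psum y n.+1 = psum y n + y (e_ n).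
Proof. by rewrite /psum big_ord_recr. Qed.

Lemma psum_cvg y : psum y @ \oo --> (ones y : R^o).
Proof.
have [//|cy _] := @linf_cvg R (fun=> 1) 1 y; first by move=> n; rewrite normr1.
suff -> : psum y = series (fun n => 1 * y (e_ n)) by exact: cy.
apply/funext => n; rewrite /psum /series /= big_mkord.
by apply: eq_bigr => i _; rewrite mul1r.
Qed.

Lemma tailE y n :
  \big[+%R/0]_(n.+1 <= i <oo) y (e_ i) = ones y - psum y n.+1.
Proof.
have h : (fun k => psum y k - psum y n.+1) @ \oo -->
    (ones y - psum y n.+1 : R^o).
  by apply: cvgB; [exact: psum_cvg | exact: cvg_cst].
apply/cvg_lim => //; apply: cvg_trans h; apply: near_eq_cvg.
exists n.+1 => // k /= nk; rewrite /psum -!(big_mkord xpredT (fun i => y (e_ i))).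
by rewrite (@big_cat_nat _ _ _ n.+1)//= addrAC subrr add0r.
Qed.

Lemma graAP x y : gra (A R) (x, y) <->
  ones y = 0 /\ forall n, x n = psum y n + psum y n.+1.
Proof.
pose a n : R := - (\big[+%R/0]_(n.+1 <= i <oo) y (e_ i)) + psum y n.
rewrite -[gra _ _]/(ones y = 0 /\ series (fun n => a n *: e_ n) @ \oo --> x).
have aE n : ones y = 0 -> a n = psum y n + psum y n.+1.
  by rewrite /a tailE => ->; ring.
split=> -[y0 xP]; split=> //.
  move=> n; rewrite -aE//.
  have /= := cvg_comp _ _ xP (@dual_continuous _ _ (dual_basis n) x).
  move=> h; apply: (cvg_unique _ h) => //; apply: cvg_near_cst.
  exists n.+1 => // k /= nk; rewrite /series /= big_mkord.
  by rewrite (c0_sumE k a) nk.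
have -> : a = x by apply/funext => n; rewrite xP aE.
exact: c0_basis_cvg.
Qed.

Lemma graT_eP x y : gra (T_e R) (x, y) <->
  ones y = 0 /\ forall n, x n = psum y n + psum y n.+1.
Proof.
rewrite /gra /T_e /bipairing /=.
have GE : ones y = 0 -> (- G y) = (fun n => psum y n + psum y n.+1).
  move=> y0; apply/funext => n; rewrite -[LHS]/(- G y n) /G tailE y0 -/(psum y n).
  by ring.
split=> -[h1 h2].
  by split=> // n; rewrite h1 GE.
by split=> //; rewrite GE//; apply/funext.
Qed.

Lemma perp_range y : ones y = 0 -> exists x : c0 R, gra (A R) (x, y).
Proof.
move=> y0; have y0' : psum y @ \oo --> (0 : R^o) by rewrite -y0; exact: psum_cvg.
have xP : (fun n => psum y n + psum y n.+1 : R^o) \in c0_pred R.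
  apply/asboolP; rewrite -[0 in X in _ --> X](addr0 (0 : R^o)).
  apply: cvgD => //; by rewrite (cvg_shiftS (psum y)).
by exists (C0 xP); apply/graAP.
Qed.

(** [x_n y_n] is the difference of the squares of two consecutive partial sums,
    so the series telescopes. *)
Lemma A_skew x y : gra (A R) (x, y) -> y x = 0.
Proof.
move=> /graAP[y0 xP].
apply: (cvg_unique _ (@dual_c0_cvg _ y x)) => //.
have -> : series (fun n => x n * y (e_ n)) = (fun n => psum y n ^+ 2).
  apply/funext => n; rewrite /series /=.
  under eq_bigr => i _.
    have -> : x i * y (e_ i) = psum y i.+1 ^+ 2 - psum y i ^+ 2.
      by rewrite xP psumS; ring.
    over.
  by rewrite telescope_sumr// /psum [X in _ - X ^+ 2]big_ord0; ring.
have := psum_cvg y; rewrite y0 => y0'.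
have := cvgM y0' y0'; rewrite mulr0 => h; exact: h.
Qed.

Lemma A_coord0 x y : gra (A R) (x, y) -> x 0%N = y (e_ 0).
Proof. by move=> /graAP[_ ->]; rewrite psumS /psum big_ord0; ring. Qed.

Lemma gra_linear a z w : gra (A R) z -> gra (A R) w -> gra (A R) (a *: z + w).
Proof.
case: z w => [x y] [x' y'] /graAP[y0 xP] /graAP[y'0 x'P]; apply/graAP; split.
  by have := bipairingDr a ones y y'; rewrite /bipairing y0 y'0 mulr0 addr0.
move=> n /=.
have pE k : psum (a *: y + y') k = a * psum y k + psum y' k.
  by rewrite /psum mulr_sumr -big_split.
rewrite -[LHS]/(a * x n + x' n) xP x'P !pE; ring.
Qed.

Lemma gra0 : gra (A R) 0.
Proof.
have [x xA] := perp_range 0 (linear0 ones).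
have := gra_linear (-1) _ _ xA xA.
by rewrite scaleN1r addNr.
Qed.

Lemma ones_dual_basis n : ones (dual_basis n) = 1.
Proof.
have h : psum (dual_basis n) @ \oo --> (1 : R^o).
  apply: cvg_near_cst.
  exists n.+1 => // k /= nk; rewrite /psum (bigD1 (Ordinal nk)) //= eqxx.
  rewrite big1 ?addr0// => i /negPf ik.
  by rewrite [n == _]eq_sym -[i == n :> nat]/(i == Ordinal nk) ik.
exact: (cvg_unique _ (psum_cvg (dual_basis n)) h).
Qed.

Lemma perp_project y : ones (- ones y *: dual_basis 0 + y) = 0.
Proof.
have := bipairingDr (- ones y) ones (dual_basis 0) y.
by rewrite /bipairing ones_dual_basis => ->; ring.
Qed.

(** Any [y] differs from [ones y *: dual_basis 0] by a sequence of sum zero. *)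
Lemma perp_annihilator (F : dual (dual (c0 R))) :
  (forall y, ones y = 0 -> F y = 0) -> F = F (dual_basis 0) *: ones.
Proof.
move=> F0; apply/val_inj/funext => y /=.
have /F0 := perp_project y.
have := bipairingDr (- ones y) F (dual_basis 0) y; rewrite /bipairing => -> Fy.
rewrite -[RHS]/(F (dual_basis 0) * ones y); lra.
Qed.

(** A constant sequence tending to [0] vanishes. *)
Lemma ones_notin_c0 x (c : R) : bidual_embed x = c *: ones -> x = 0.
Proof.
move=> xc; have xn n : x n = c.
  have := congr1 (fun F : dual (dual (c0 R)) => F (dual_basis n)) xc.
  by rewrite /= -[RHS]/(c * ones (dual_basis n)) ones_dual_basis mulr1.
have c0' : c = 0.
  apply: (cvg_unique _ _ (c0_cvg x)) => //.
  by apply: cvg_near_cst; apply: nearW.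
by apply/val_inj/funext => n /=; rewrite xn c0'.
Qed.

End GossezOperator.

(** * Properties of the operator [A] *)

Section GossezProperties.
Context {R : realType}.
Implicit Types (x : c0 R) (y : dual (c0 R)).

Lemma gra_skew z : gra (A R) z -> pairing z.1 z.2 = 0.
Proof. by case: z => x y; exact: A_skew. Qed.

Lemma gra_polar z w : gra (A R) z -> gra (A R) w ->
  pairing z.1 w.2 + pairing w.1 z.2 = 0.
Proof.
exact: (skew_polar pairing pairingDl pairingDr _ gra_linear gra_skew).
Qed.

Lemma dual_basis_e0 : dual_basis 0 (e_ 0) = 1 :> R.
Proof. by []. Qed.

(** Orthogonality to the graph forces [x] to be [a - t e_0], where [t] is the
    sum of [y] and [(a, b)] the point of the graph with [b] equal to [y] minus
    [t] in its first entry; the pairing of [x] and [y] is then [- t ^ 2]. *)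
Lemma A_maximal : maximally_monotone pairing (gra (A R)).
Proof.
apply: (skew_maximal pairing pairingDl pairingDr _ gra0 gra_linear gra_skew).
move=> [x y] /= yx polar; set t := ones y.
have [a Aa] := perp_range _ (perp_project y); rewrite -/t in Aa.
set b := _ + y in Aa.
have yE : y = t *: dual_basis 0 + b.
  by rewrite /b addrA -scalerDl addrN scale0r add0r.
clearbody b.
have v0 : t *: e_ 0 + (x - a) = 0.
  apply: (@ones_notin_c0 R _ (bidual_embed (t *: e_ 0 + (x - a)) (dual_basis 0))).
  apply: perp_annihilator => b' /perp_range[a' Aa'].
  (* The first entries of [a'] and [b'] agree, so the terms in [t] cancel. *)
  have h1 : pairing x b' + pairing a' y = 0 := polar _ Aa'.
  have h2 : pairing a b' + pairing a' b = 0 := gra_polar _ _ Aa Aa'.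
  have h3 := A_coord0 _ _ Aa'.
  rewrite -[LHS]/(pairing (t *: e_ 0 + (x - a)) b').
  rewrite pairingDl (bilBl pairing pairingDl).
  move: h1 h2; rewrite yE pairingDr [pairing a' (dual_basis 0)]h3.
  rewrite [pairing (e_ 0) b']/pairing; lra.
have xE : x = - t *: e_ 0 + a.
  by apply/eqP; rewrite -subr_eq0 opprD addrCA addrA -scaleNr opprK -addrA v0.
have t0 : t = 0.
  have : 0 <= pairing x y := yx; rewrite xE yE pairingDl !pairingDr.
  rewrite [pairing a b](gra_skew _ Aa).
  rewrite [pairing a _](A_coord0 _ _ Aa) [pairing _ (dual_basis 0)]dual_basis_e0.
  rewrite [pairing _ b]/pairing; nra.
have -> : x = a by rewrite xE t0 oppr0 scale0r add0r.
by have -> : y = b by rewrite yE t0 scale0r add0r.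
Qed.

Lemma ones_le y : `|ones y| <= `|y|.
Proof.
rewrite -[leRHS]mul1r; apply: (@linf_cvg R (fun=> 1) 1 y _).2 => n.
by rewrite normr1.
Qed.

(** The pairing of [(- e_0 - x, dual_basis 0 - y)] is [-1 - x_0 + y_0 = -1] on
    the whole graph, while [ones] has norm at most [1] and takes the value [1]
    at [dual_basis 0 - y].  Any radii with [b <= 1] and [1 < a * b] work. *)
Lemma A_not_type_BR : ~ type_BR (A R).
Proof.
move=> /(_ (- e_ 0) (dual_basis 0) 2 1 (ltr0n _ 2) ltr01)[|[x y] [/= Axy _]].
  apply: (@lt_le_trans _ _ (-1)%:E); first by rewrite lte_fin; lra.
  apply: le_ereal_inf_tmp => _ [[x y] Axy <-]; rewrite lee_fin.
  suff h : pairing (- e_ 0 - x) (dual_basis 0 - y) = -1 by rewrite -{1}h.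
  rewrite (bil_sub pairing pairingDl pairingDr) [pairing x y](gra_skew _ Axy).
  rewrite [pairing x _](A_coord0 _ _ Axy) -scaleN1r.
  rewrite !(bilZl pairing pairingDl) [pairing _ (dual_basis 0)]dual_basis_e0.
  rewrite [pairing _ y]/pairing; lra.
rewrite ltNge => /negP; apply; apply: le_trans (ones_le _).
have := bilBr bipairing bipairingDr ones (dual_basis 0) y.
move: (Axy) => /graAP[y0 _]; rewrite /bipairing y0 ones_dual_basis => ->.
by rewrite subr0 normr1.
Qed.

(** The graph of [A], embedded in the bidual setting, plus the line through
    [(u, v)]. *)
Definition extension (u : dual (dual (c0 R))) (v : dual (c0 R)) :
    set (dual (dual (c0 R)) * dual (c0 R)) :=
  [set z | exists w t, gra (A R) w /\
     z = (t *: u + bidual_embed w.1, t *: v + w.2)].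

Lemma extension_sub u v :
  [set (bidual_embed z.1, z.2) | z in gra (A R)] `<=` extension u v.
Proof. by move=> _ [w Aw <-]; exists w, 0; rewrite !scale0r !add0r. Qed.

Lemma bidual_embed0 : bidual_embed (0 : c0 R) = 0.
Proof. by apply/val_inj/funext => f /=; rewrite linear0. Qed.

Lemma extension_mem u v : extension u v (u, v).
Proof.
exists 0, 1; split; first exact: gra0.
by rewrite !scale1r /= bidual_embed0 !addr0.
Qed.

Section Extension.
Context (u : dual (dual (c0 R))) (v : dual (c0 R)).
Hypothesis uv0 : u v = 0.
Hypothesis uvA : forall w, gra (A R) w -> u w.2 + v w.1 = 0.

Lemma extension0 : extension u v 0.
Proof.
exists 0, 0; split; first exact: gra0.
by rewrite !scale0r !add0r bidual_embed0.
Qed.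

Lemma extension_linear a z w :
  extension u v z -> extension u v w -> extension u v (a *: z + w).
Proof.
move=> [z' [t [Az ->]]] [w' [s [Aw ->]]].
exists (a *: z' + w'), (a * t + s); split; first exact: gra_linear.
congr pair => /=.
  have -> : bidual_embed (a *: z'.1 + w'.1) =
      a *: bidual_embed z'.1 + bidual_embed w'.1.
    by apply/val_inj/funext => f /=; rewrite linearP.
  by rewrite scalerDr scalerDl scalerA addrACA.
by rewrite scalerDr scalerDl scalerA addrACA.
Qed.

Lemma extension_skew z : extension u v z -> bipairing z.1 z.2 = 0.
Proof.
move=> [w [t [Aw ->]]].
have h : bipairing u w.2 + bipairing (bidual_embed w.1) v = 0 := uvA _ Aw.
rewrite -[LHS]/(bipairing (t *: u + bidual_embed w.1) (t *: v + w.2)).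
rewrite bipairingDl !bipairingDr [bipairing u v]uv0.
rewrite [bipairing (bidual_embed _) w.2](gra_skew _ Aw) mulr0 add0r addr0.
by rewrite -mulrDr h mulr0.
Qed.

Lemma extension_polar z w : extension u v z -> extension u v w ->
  bipairing z.1 w.2 + bipairing w.1 z.2 = 0.
Proof.
exact: (skew_polar bipairing bipairingDl bipairingDr _ extension_linear
  extension_skew).
Qed.

End Extension.

(** Orthogonality to [(ones, 0)] forces the sum of [y] to be zero, so some
    [(a, y)] lies in the graph; then [F] minus [a] kills the sequences of sum
    zero, hence is a multiple of [ones]. *)
Lemma extension_by_ones_maximal :
  maximally_monotone bipairing (extension ones 0).
Proof.
have uvA w : gra (A R) w -> ones w.2 + (0 : dual (c0 R)) w.1 = 0.
  by case: w => x y /graAP[/= -> _]; exact: addr0.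
have uv0 : ones (0 : dual (c0 R)) = 0 by exact: linear0.
apply: (skew_maximal bipairing bipairingDl bipairingDr _ (extension0 _ _)
  (extension_linear _ _) (extension_skew _ _ uv0 uvA)) => -[F y] /= _ polar.
have y0 : ones y = 0.
  have : bipairing F 0 + bipairing ones y = 0 := polar _ (extension_mem _ _).
  by rewrite (bil0r bipairing bipairingDr) add0r.
have [a Aa] := perp_range _ y0.
have FaE : F - bidual_embed a = (F - bidual_embed a) (dual_basis 0) *: ones.
  apply: perp_annihilator => b' /perp_range[a' Aa'].
  have h1 : pairing a b' + pairing a' y = 0 := gra_polar _ _ Aa Aa'.
  have h2 : bipairing F b' + pairing a' y = 0.
    exact: polar (extension_sub _ _ _ (ex_intro2 _ _ _ Aa' erefl)).
  have := bilBl bipairing bipairingDl F (bidual_embed a) b'.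
  rewrite [bipairing (bidual_embed a) b']/(pairing a b') {1}/bipairing => ->; lra.
exists (a, y), ((F - bidual_embed a) (dual_basis 0)); split; first exact: Aa.
by rewrite -FaE subrK scaler0 add0r.
Qed.

Lemma ones_e0_A w : gra (A R) w ->
  (ones - bidual_embed (e_ 0)) w.2 + dual_basis 0 w.1 = 0.
Proof.
case: w => x y Axy /=; have := A_coord0 _ _ Axy; move: Axy => /graAP[y0 _] xy.
rewrite -[X in X + _]/(ones y - y (e_ 0)) y0 xy; ring.
Qed.

Lemma ones_e0_dual_basis : (ones - bidual_embed (e_ 0)) (dual_basis 0) = 0 :> R.
Proof.
rewrite -[LHS]/(ones (dual_basis 0) - dual_basis 0 (e_ 0)) ones_dual_basis dual_basis_e0.
by rewrite subrr.
Qed.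

(** The added line makes the range all of l^1, since [dual_basis 0] spans a
    complement of the sequences of sum zero. *)
Lemma extension_by_dual_basis_maximal :
  maximally_monotone bipairing
    (extension (ones - bidual_embed (e_ 0)) (dual_basis 0)).
Proof.
apply: (skew_full_range_maximal bipairing bipairingDl bipairingDr _
  (extension0 _ _) (extension_linear _ _)
  (extension_skew _ _ ones_e0_dual_basis ones_e0_A)).
  by move=> F F0; apply/val_inj/funext.
move=> y; have [a Aa] := perp_range _ (perp_project y).
exists (ones y *: (ones - bidual_embed (e_ 0)) + bidual_embed a).
exists (a, - ones y *: dual_basis 0 + y), (ones y); split=> //=.
by rewrite addrA -scalerDl addrN scale0r add0r.
Qed.

(** The two extensions are skew, so if they coincided then [(ones, 0)] and
    [(ones - e_0, dual_basis 0)] would be orthogonal to each other. *)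
Lemma A_not_unique : ~ type_unique (A R).
Proof.
move=> /(_ _ _ extension_by_ones_maximal extension_by_dual_basis_maximal
  (extension_sub _ _) (extension_sub _ _)) E12.
have E10 := extension_mem ones 0.
rewrite E12 in E10.
have : bipairing ones (dual_basis 0 : dual (c0 R)) +
    bipairing (ones - bidual_embed (e_ 0)) 0 = 0.
  exact: extension_polar _ _ ones_e0_dual_basis ones_e0_A _ _ E10 (extension_mem _ _).
rewrite (bil0r bipairing bipairingDr) addr0 [bipairing _ _]ones_dual_basis.
by move/eqP; rewrite oner_eq0.
Qed.

Lemma lift_A_not_type_D (X : normedModType R) (T : {linear c0 R -> X}) (M : R)
    (TM : forall x, `|T x| <= M * `|x|) (f : dual X) :
  pullback T M TM f = dual_basis 0 -> ~ type_D (operator_lift T M TM (A R)).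
Proof.
move=> fT; apply: (@lift_not_type_D _ _ _ _ _ _ _
  (ones - bidual_embed (e_ 0)) f ones).
- move=> [x y] Axy; rewrite fT (_ : bipairing _ _ = 0)//.
  have h : bipairing (ones - bidual_embed (e_ 0)) y +
    bipairing (bidual_embed x) (dual_basis 0) = 0 := ones_e0_A _ Axy.
  rewrite -[LHS]/(bipairing
    (bidual_embed x - (ones - bidual_embed (e_ 0))) (y - dual_basis 0)).
  rewrite (bil_sub bipairing bipairingDl bipairingDr) [X in _ - X + _]addrC h.
  rewrite [bipairing _ (dual_basis 0)]ones_e0_dual_basis.
  by rewrite [bipairing _ _](gra_skew _ Axy) !subr0 addr0.
- by move=> [x y] /graAP[].
- by rewrite fT ones_dual_basis oner_neq0.
Qed.

End GossezProperties.

Theorem corollary4p12 (R : realType) :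
  (forall y : dual (c0 R), perp ones y -> exists x : c0 R, gra (A R) (x, y)) /\
  gra (A R) = gra (T_e R) /\
  maximally_monotone pairing (gra (A R)) /\
  skew_operator (A R) /\
  ~ type_BR (A R) /\
  ~ type_unique (A R) /\
  ~ type_D (A R) /\
  (forall X : completeNormedModType R, contains_copy (c0 R) X ->
     ~ space_type_D X).
Proof.
split; first by move=> y; exact: perp_range.
split.
  by apply/seteqP; split=> -[x y]; rewrite graAP graT_eP.
split; first exact: A_maximal.
split; first by move=> z; exact: gra_skew.
split; first exact: A_not_type_BR.
split; first exact: A_not_unique.
split.
  have id1 (x : c0 R) : `|idfun x| <= 1 * `|x| by rewrite mul1r.
  (* [A] is its own lift along the identity. *)
  have <- : operator_lift idfun 1 id1 (A R) = A R.
    apply/funext => x; apply/seteqP.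
    have pullK y : pullback idfun 1 id1 y = y by exact/val_inj.
    split=> y; first by move=> [z ->]; rewrite pullK.
    by move=> Axy; exists x; rewrite ?pullK.
  by apply: (lift_A_not_type_D _ _ _ _ (dual_basis 0)); exact/val_inj.
move=> X [T [m [M [m0 mTM]]]] XD.
have mT z : m * `|z| <= `|T z| by have /andP[] := mTM z.
have TM z : `|T z| <= M * `|z| by have /andP[] := mTM z.
have [f fT] := pullback_surjective T m M m0 mT TM (dual_basis 0).
apply: (lift_A_not_type_D _ _ _ TM f fT).
exact: XD _ (lift_maximal T m M m0 mT TM _ A_maximal).
Qed.
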